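(* Let $\boldsymbol x^0=(\boldsymbol B_V^0,\boldsymbol E_D^0,p_D^0)^T$ be an initial guess for the MFD system $\mathcal A\boldsymbol x=\boldsymbol b$ satisfying $\mathrm{div}_V\boldsymbol B_V^0=0$, and let the right-hand side $\boldsymbol b=(\boldsymbol g_{\boldsymbol B}^V,\boldsymbol g_{\boldsymbol E}^D,g_p^D)^T$ satisfy $\mathrm{div}_V\boldsymbol g_{\boldsymbol B}^V=0$. Let $\mathcal X$ be any of the preconditioners $\mathcal X_{\mathcal{LS}}=\mathcal Q\mathcal L^{-1}$, $\mathcal X_{\mathcal{SU}}=\mathcal U^{-1}\mathcal Q$, $\mathcal X_{\mathcal{LSU}}=\mathcal U^{-1}\mathcal Q\mathcal L^{-1}$. Then all iterates $\boldsymbol x^k=(\boldsymbol B_V^k,\boldsymbol E_D^k,p_D^k)^T$ of the GMRES method preconditioned by $\mathcal X$ satisfy $\mathrm{div}_V\boldsymbol B_V^k=0$.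
   Context: Mesh. A bounded connected domain $\Omega\subset\mathbb R^3$ carries a Delaunay tetrahedral mesh (tetrahedra $D_k$, vertices $\boldsymbol x_i^D$, edges $\boldsymbol e_{ij}^D$, faces $\partial D_{km}$), with circumcenters in the interior of the tetrahedra, and the dual Voronoi mesh (cells $V_i$, nodes $\boldsymbol x_k^V$ = circumcenters of $D_k$, edges $\boldsymbol e_{km}^V$ joining $\boldsymbol x_k^V,\boldsymbol x_m^V$, faces $\partial V_{ij}$ common to $V_i,V_j$). Delaunay vertices, edges, faces, tetrahedra correspond one-to-one to Voronoi cells, faces, edges, nodes. $\mathcal G$, $\mathcal K$ are the signed edge-vertex and face-edge incidence matrices of the Delaunay mesh, $\mathcal G_V$ the signed edge-vertex incidence matrix of the Voronoi mesh (entries $0,\pm1$, consistent with fixed orientations). Diagonal matrices with positive entries: $\mathcal D_{\boldsymbol e^D}=\mathrm{diag}(|\boldsymbol e_{ij}^D|)$, $\mathcal D_{\partial D}=\mathrm{diag}(|\partial D_{km}|)$, $\mathcal D_D=\mathrm{diag}(|D_k|)$, $\mathcal D_{\boldsymbol e^V}=\mathrm{diag}(|\boldsymbol e_{km}^V|)$, $\mathcal D_{\partial V}=\mathrm{diag}(|\partial V_{ij}|)$, $\mathcal D_V=\mathrm{diag}(|V_i|)$. MFD operators (matrices): $\mathrm{grad}_D=\mathcal D_{\boldsymbol e^D}^{-1}\mathcal G$, $\mathrm{div}_D=\mathcal D_V^{-1}\mathcal G^T\mathcal D_{\partial V}$, $\mathrm{curl}_D=\mathcal D_{\partial D}^{-1}\mathcal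 K\mathcal D_{\boldsymbol e^D}$, $\mathrm{grad}_V=\mathcal D_{\boldsymbol e^V}^{-1}\mathcal G_V$, $\mathrm{div}_V=\mathcal D_D^{-1}\mathcal G_V^T\mathcal D_{\partial D}$, $\mathrm{curl}_V=\mathcal D_{\partial V}^{-1}\mathcal K^T\mathcal D_{\boldsymbol e^V}$. These satisfy (known) $\mathrm{curl}_D\mathrm{grad}_D=0$, $\mathrm{curl}_V\mathrm{grad}_V=0$, $\mathrm{div}_V\mathrm{curl}_D=0$, $\mathrm{div}_D\mathrm{curl}_V=0$. System matrix, for time step $\tau>0$: with identity matrices $\mathcal I_{\boldsymbol e^V},\mathcal I_{\boldsymbol e^D},\mathcal I_V$ (indexed by Voronoi edges, Delaunay edges, Voronoi cells), $$\mathcal A=\begin{bmatrix}\frac2\tau\mathcal I_{\boldsymbol e^V}&\mathrm{curl}_D&0\\-\mathrm{curl}_V&\frac2\tau\mathcal I_{\boldsymbol e^D}&\mathrm{grad}_D\\0&-\mathrm{div}_D&\frac2\tau\mathcal I_V\end{bmatrix}.$$ Let $$\mathcal L=\begin{bmatrix}\mathcal I_{\boldsymbol e^V}&&\\-\frac\tau2\mathrm{curl}_V&\mathcal I_{\boldsymbol e^D}&\\&-\frac\tau2\mathrm{div}_D&\mathcal I_V\end{bmatrix},\qquad\mathcal U=\begin{bmatrix}\mathcal I_{\boldsymbol e^V}&\frac\tau2\mathrm{curl}_D&\\&\mathcal I_{\boldsymbol e^D}&\frac\tau2\mathrm{grad}_D\\&&\mathcal I_V\end{bmatrix}.$$ $\mathcal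 Q_{\boldsymbol E}$ and $\mathcal Q_p$ are given matrices, serving as preconditioners for the Schur complements $\mathcal S_{\boldsymbol E}=\frac\tau2\mathrm{curl}_V\mathrm{curl}_D+\frac2\tau\mathcal I_{\boldsymbol e^D}$ and $\mathcal S_p=\frac\tau2\mathrm{div}_D\mathrm{grad}_D+\frac2\tau\mathcal I_V$, and $\mathcal Q=\mathrm{diag}\big((\frac2\tau\mathcal I_{\boldsymbol e^V})^{-1},\mathcal Q_{\boldsymbol E},\mathcal Q_p\big)$. Preconditioned GMRES: with $\boldsymbol r^0=\mathcal X(\boldsymbol b-\mathcal A\boldsymbol x^0)$, the $k$-th iterate $\boldsymbol x^k$ is a minimizer of the Euclidean norm $\|\mathcal X(\boldsymbol b-\mathcal A\boldsymbol x)\|$ over $\boldsymbol x\in\boldsymbol x^0+\mathrm{span}\{\boldsymbol r^0,\mathcal X\mathcal A\boldsymbol r^0,\dots,(\mathcal X\mathcal A)^{k-1}\boldsymbol r^0\}$. Here superscripts $0,k$ denote GMRES iteration indices within a single time step. *)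

(* Defs.v *)
From HB Require Import structures.
From mathcomp Require Import all_boot all_order all_algebra.
From mathcomp Require Import all_classical all_reals all_analysis.
Import Order.TTheory GRing.Theory Num.Theory.
Import numFieldNormedType.Exports.

Set Implicit Arguments.
Unset Strict Implicit.
Unset Printing Implicit Defensive.

Local Open Scope classical_set_scope.
Local Open Scope ring_scope.

Section Euclid.
Variable R : realType.

Definition dotmul n (u v : 'cV[R]_n) : R := \sum_i u i 0 * v i 0.

(* The norm `|u| of mathcomp-analysis on matrices is the sup norm. *)
Definition enorm n (u : 'cV[R]_n) : R := Num.sqrt (dotmul u u).

(* Indices are taken modulo 3. *)
Definition crossmul (u v : 'cV[R]_3) : 'cV[R]_3 :=
  \col_(i < 3) (u (i + 1) 0 * v (i + 2%:R) 0 - u (i + 2%:R) 0 * v (i + 1) 0).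

Definition volume (S : set 'cV[R]_3) : R :=
  fine (((@lebesgue_measure R \x @lebesgue_measure R) \x @lebesgue_measure R)%E
    [set a : R * R * R | S (\col_(i < 3) [tuple a.1.1; a.1.2; a.2]`_i)]).

(* Area of a set lying in a plane with unit normal n: the volume of the right
   prism of height 1 over it. *)
Definition planar_area (n : 'cV[R]_3) (S : set 'cV[R]_3) : R :=
  volume [set x | exists2 y, S y & exists2 t : R, 0 <= t <= 1 & x = y + t *: n].

Definition conv_hull (I : finType) (pt : I -> 'cV[R]_3) (s : {set I}) :
    set 'cV[R]_3 :=
  [set x | exists w : I -> R,
    [/\ forall i, 0 <= w i, forall i, i \notin s -> w i = 0,
        \sum_i w i = 1 & x = \sum_i w i *: pt i]].

Definition voronoi_cell (I : finType) (pt : I -> 'cV[R]_3) (i : I) :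
    set 'cV[R]_3 :=
  [set x | forall j, enorm (x - pt i) <= enorm (x - pt j)].

End Euclid.

Section Complex.
Variables (nP nT : nat) (tet : 'I_nT -> 'I_4 -> 'I_nP).

Definition vset n (c : 'I_n -> 'I_nP) : {set 'I_nP} := [set c i | i : 'I_n]%SET.

Definition is_simplex (s : {set 'I_nP}) := [exists k, s \subset vset (tet k)].

Definition boundary_face (s : {set 'I_nP}) :=
  (#|s| == 3)%N && (#|[set k | s \subset vset (tet k)]%SET| == 1)%N.

Definition interior_simplex (s : {set 'I_nP}) :=
  is_simplex s && [forall g, boundary_face g ==> ~~ (s \subset g)].

(* c lists, without repetition, the simplices with m vertices that are not
   contained in a face of ess. *)
Definition enumerates (ess : {set {set 'I_nP}}) (m n : nat)
    (c : 'I_n -> {set 'I_nP}) :=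
  injective c /\
  forall s, (exists i, c i = s) <->
    [/\ #|s| = m, is_simplex s & forall g, g \in ess -> ~~ (s \subset g)].

End Complex.

(* The mesh has points pt and tetrahedra tet.  The discrete unknowns live on
   the simplices listed by vert, edge and face (and dually on the Voronoi
   cells, faces and edges): all those that are not contained in a face of
   ess_faces, a set of boundary faces.  With ess_faces empty, every simplex of
   the mesh is listed; with ess_faces the set of all boundary faces, only the
   interior ones are, as when homogeneous essential conditions are eliminated.

   Orientations: edge e goes from edge e 0 to edge e 1; face f has the cyclic
   order (face f 0, face f 1, face f 2).

   A simplex that touches the boundary has an unbounded or truncated dual
   Voronoi element.  The size of that element depends on the truncation chosen
   and may be any positive number; the sizes of the other Voronoi elements are
   their Euclidean length, area and volume. *)
Record delaunay_mesh (R : realType) := DelaunayMesh {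
  domain : set 'cV[R]_3;
  nP : nat; nV : nat; nE : nat; nF : nat; nT : nat;
  pt : 'I_nP -> 'cV[R]_3;
  tet : 'I_nT -> 'I_4 -> 'I_nP;
  ess_faces : {set {set 'I_nP}};
  vert : 'I_nV -> 'I_nP;
  edge : 'I_nE -> 'I_2 -> 'I_nP;
  face : 'I_nF -> 'I_3 -> 'I_nP;
  circumcenter : 'I_nT -> 'cV[R]_3;
  voronoi_length : 'I_nF -> R;
  voronoi_area : 'I_nE -> R;
  voronoi_volume : 'I_nV -> R;

  domain_nonempty : domain !=set0;
  domain_open : open domain;
  domain_connected : connected domain;
  domain_bounded : bounded_set domain;

  pt_inj : injective pt;
  pt_used : forall i, exists k, i \in vset (tet k);
  tet_inj : injective (fun k => vset (tet k));
  tet_nondegenerate : forall k,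
    dotmul (crossmul (pt (tet k 1) - pt (tet k 0)) (pt (tet k 2%:R) - pt (tet k 0)))
      (pt (tet k 3%:R) - pt (tet k 0)) != 0;
  tet_cover : closure domain = \bigcup_k conv_hull pt (vset (tet k));
  tet_conforming : forall k m,
    conv_hull pt (vset (tet k)) `&` conv_hull pt (vset (tet m)) =
    conv_hull pt (vset (tet k) :&: vset (tet m))%SET;

  circumcenter_eq : forall k i j, i \in vset (tet k) -> j \in vset (tet k) ->
    enorm (circumcenter k - pt i) = enorm (circumcenter k - pt j);
  delaunay : forall k i j, i \in vset (tet k) ->
    enorm (circumcenter k - pt i) <= enorm (circumcenter k - pt j);
  circumcenter_interior : forall k,
    interior (conv_hull pt (vset (tet k))) (circumcenter k);

  ess_boundary : forall g, g \in ess_faces -> boundary_face tet g;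
  vert_enum : enumerates tet ess_faces 1 (fun i => [set vert i]%SET);
  edge_enum : enumerates tet ess_faces 2 (fun e => vset (edge e));
  face_enum : enumerates tet ess_faces 3 (fun f => vset (face f));

  voronoi_length_gt0 : forall f, 0 < voronoi_length f;
  voronoi_area_gt0 : forall e, 0 < voronoi_area e;
  voronoi_volume_gt0 : forall i, 0 < voronoi_volume i;
  voronoi_lengthE : forall f k m, k != m ->
    vset (face f) \subset vset (tet k) -> vset (face f) \subset vset (tet m) ->
    voronoi_length f = enorm (circumcenter k - circumcenter m);
  voronoi_areaE : forall e, interior_simplex tet (vset (edge e)) ->
    let d := pt (edge e 1) - pt (edge e 0) in
    voronoi_area e = planar_area ((enorm d)^-1 *: d)
      (voronoi_cell pt (edge e 0) `&` voronoi_cell pt (edge e 1));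
  voronoi_volumeE : forall i, interior_simplex tet [set vert i]%SET ->
    voronoi_volume i = volume (voronoi_cell pt (vert i))
}.

Section MFD.
Variables (R : realType) (M : delaunay_mesh R).

(* Twice the vector area of the oriented face f. *)
Definition face_normal (f : 'I_(nF M)) : 'cV[R]_3 :=
  let p i := pt (face f i) in crossmul (p 1 - p 0) (p 2%:R - p 0).

Definition edge_length (e : 'I_(nE M)) : R :=
  enorm (pt (edge e 1) - pt (edge e 0)).
Definition face_area (f : 'I_(nF M)) : R := enorm (face_normal f) / 2%:R.
Definition tet_volume (k : 'I_(nT M)) : R :=
  let p i := pt (tet k i) in
  `|dotmul (crossmul (p 1 - p 0) (p 2%:R - p 0)) (p 3%:R - p 0)| / 6%:R.

Definition G : 'M[R]_(nE M, nV M) :=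
  \matrix_(e, i) ((vert i == edge e 1)%:R - (vert i == edge e 0)%:R).

Definition K : 'M[R]_(nF M, nE M) :=
  \matrix_(f, e) \sum_(i < 3)
    (((edge e 0 == face f i) && (edge e 1 == face f (i + 1)))%:R
     - ((edge e 1 == face f i) && (edge e 0 == face f (i + 1)))%:R).

(* The Voronoi edge dual to f is oriented along face_normal f: its head is the
   circumcenter on the positive side of f, its tail the one on the negative
   side. *)
Definition GV : 'M[R]_(nF M, nT M) :=
  \matrix_(f, k) if vset (face f) \subset vset (tet k)
    then Num.sg (dotmul (face_normal f) (circumcenter k - pt (face f 0))) else 0.

Definition DeD : 'M[R]_(nE M) := diag_mx (\row_e edge_length e).
Definition DdD : 'M[R]_(nF M) := diag_mx (\row_f face_area f).
Definition DD : 'M[R]_(nT M) := diag_mx (\row_k tet_volume k).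
Definition DeV : 'M[R]_(nF M) := diag_mx (\row_f voronoi_length f).
Definition DdV : 'M[R]_(nE M) := diag_mx (\row_e voronoi_area e).
Definition DV : 'M[R]_(nV M) := diag_mx (\row_i voronoi_volume i).

Definition gradD : 'M[R]_(nE M, nV M) := invmx DeD *m G.
Definition divD : 'M[R]_(nV M, nE M) := invmx DV *m G^T *m DdV.
Definition curlD : 'M[R]_(nF M, nE M) := invmx DdD *m K *m DeD.
Definition gradV : 'M[R]_(nF M, nT M) := invmx DeV *m GV.
Definition divV : 'M[R]_(nT M, nF M) := invmx DD *m GV^T *m DdD.
Definition curlV : 'M[R]_(nE M, nF M) := invmx DdV *m K^T *m DeV.

Variable tau : R.

Definition dofs := (nF M + (nE M + nV M))%N.

Definition block3 (a11 : 'M[R]_(nF M)) (a12 : 'M[R]_(nF M, nE M))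
    (a13 : 'M[R]_(nF M, nV M)) (a21 : 'M[R]_(nE M, nF M)) (a22 : 'M[R]_(nE M))
    (a23 : 'M[R]_(nE M, nV M)) (a31 : 'M[R]_(nV M, nF M))
    (a32 : 'M[R]_(nV M, nE M)) (a33 : 'M[R]_(nV M)) : 'M[R]_dofs :=
  block_mx a11 (row_mx a12 a13)
           (col_mx a21 a31) (block_mx a22 a23 a32 a33).

Definition col3 (B : 'cV[R]_(nF M)) (E : 'cV[R]_(nE M)) (p : 'cV[R]_(nV M)) :
    'cV[R]_dofs := col_mx B (col_mx E p).

Definition system_mx : 'M[R]_dofs :=
  block3 (2%:R / tau)%:M  curlD               0
         (- curlV)        (2%:R / tau)%:M     gradD
         0                (- divD)            (2%:R / tau)%:M.

Definition L_mx : 'M[R]_dofs :=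
  block3 1%:M                        0                        0
         (- ((tau / 2%:R) *: curlV)) 1%:M                     0
         0                           (- ((tau / 2%:R) *: divD)) 1%:M.

Definition U_mx : 'M[R]_dofs :=
  block3 1%:M ((tau / 2%:R) *: curlD) 0
         0    1%:M                    ((tau / 2%:R) *: gradD)
         0    0                       1%:M.

Definition Q_mx (QE : 'M[R]_(nE M)) (Qp : 'M[R]_(nV M)) : 'M[R]_dofs :=
  block3 (invmx (2%:R / tau)%:M) 0  0
         0                       QE 0
         0                       0  Qp.

Definition X_LS QE Qp : 'M[R]_dofs := Q_mx QE Qp *m invmx L_mx.
Definition X_SU QE Qp : 'M[R]_dofs := invmx U_mx *m Q_mx QE Qp.
Definition X_LSU QE Qp : 'M[R]_dofs := invmx U_mx *m Q_mx QE Qp *m invmx L_mx.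

End MFD.

Section GMRES.
Variables (R : realType) (n : nat) (X A : 'M[R]_n) (b x0 : 'cV[R]_n).

Definition krylov (k : nat) : {vspace 'cV[R]_n} :=
  (<<[seq (X *m A) ^+ j *m (X *m (b - A *m x0)) | j <- iota 0 k]>>)%VS.

Definition gmres_iterate (k : nat) (x : 'cV[R]_n) : Prop :=
  x - x0 \in krylov k /\
  forall y, y - x0 \in krylov k ->
    enorm (X *m (b - A *m x)) <= enorm (X *m (b - A *m y)).

End GMRES.

(* Main.v *)
Require Import Defs.
From HB Require Import structures.
From mathcomp Require Import all_boot all_order all_algebra.
From mathcomp Require Import all_classical all_reals all_analysis.
From mathcomp Require Import ring lra.
Import Order.TTheory GRing.Theory Num.Theory.
Import numFieldNormedType.Exports.
Local Open Scope ring_scope.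

(** Let P be the block row (divV, 0, 0), so that P x is the divergence of the
    magnetic component of x.  The identity divV curlD = 0 says that P annihilates
    the coupling blocks in the first block row of the system matrix A and of U,
    while the first block row of L and of Q is diagonal anyway.  Hence P A, P L,
    P U and P Q are scalar multiples of P, the multiple being 1 for L and U; so
    P L^-1 = P, P U^-1 = P, and P X is a multiple of P for each of the three
    preconditioners X.  Since P annihilates x0 and b, it annihilates the initial
    preconditioned residual, then every (X A)^j applied to it, hence the whole
    Krylov space ([mul_krylov]); and a GMRES iterate differs from x0 by an element
    of the Krylov space.  The minimization property of the iterates plays no role.

    The identity divV curlD = 0 ([divV_curlD]) reduces, once the face areas have
    been cancelled, to GV^T K = 0 ([GVT_K]): the boundary of the boundary of a
    tetrahedron is zero.  Orientations are given geometrically, GV being the side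
    of a face on which the circumcenter lies.  As the circumcenter is interior to
    its tetrahedron, this is the side of the opposite vertex
    ([interior_height_sg]), so the incidence numbers are signs of determinants.
    If a tetrahedron has vertices a, b, c, d, each of its two faces containing the
    edge ab contributes the sign of the determinant of (a, b, c, d) or of
    (a, b, d, c), whatever the orientation of the face ([GV_K_sg]), and these
    cancel.  Both faces are among the listed ones when the edge is
    ([exists_face]). *)

Set Implicit Arguments.
Unset Strict Implicit.
Unset Printing Implicit Defensive.

(** * Oriented volumes and heights over a plane *)

Section Vectors.
Variable R : realType.
Implicit Types a b c d u v : 'cV[R]_3.

Lemma ord3_1 : lift ord0 ord0 = 1 :> 'I_3.
Proof. exact: val_inj. Qed.

Lemma ord3_2 : lift ord0 (lift ord0 ord0) = 2%:R :> 'I_3.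
Proof. exact: val_inj. Qed.

Lemma dotmul3 u v :
  dotmul u v = u 0 0 * v 0 0 + u 1 0 * v 1 0 + u 2%:R 0 * v 2%:R 0.
Proof. by rewrite /dotmul !big_ord_recl big_ord0 addr0 addrA ord3_1 ord3_2. Qed.

Lemma crossmul3 u v :
  (crossmul u v 0 0 = u 1 0 * v 2%:R 0 - u 2%:R 0 * v 1 0) *
  (crossmul u v 1 0 = u 2%:R 0 * v 0 0 - u 0 0 * v 2%:R 0) *
  (crossmul u v 2%:R 0 = u 0 0 * v 1 0 - u 1 0 * v 0 0).
Proof.
have h1 : (1 + 1 : 'I_3) = 2%:R by exact: val_inj.
have h2 : (1 + 2%:R : 'I_3) = 0 by exact: val_inj.
have h3 : (2%:R + 1 : 'I_3) = 0 by exact: val_inj.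
have h4 : (2%:R + 2%:R : 'I_3) = 1 by exact: val_inj.
by rewrite !mxE !add0r h1 h2 h3 h4.
Qed.

(** Six times the oriented volume of the tetrahedron with vertices a, b, c, d;
    positive when d is on the side of the plane abc to which (b-a) x (c-a)
    points. *)
Definition signed_volume a b c d := dotmul (crossmul (b - a) (c - a)) (d - a).

Lemma signed_volumeE a b c d : signed_volume a b c d =
  ((b 1 0 - a 1 0) * (c 2%:R 0 - a 2%:R 0)
    - (b 2%:R 0 - a 2%:R 0) * (c 1 0 - a 1 0)) * (d 0 0 - a 0 0)
  + ((b 2%:R 0 - a 2%:R 0) * (c 0 0 - a 0 0)
    - (b 0 0 - a 0 0) * (c 2%:R 0 - a 2%:R 0)) * (d 1 0 - a 1 0)
  + ((b 0 0 - a 0 0) * (c 1 0 - a 1 0)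
    - (b 1 0 - a 1 0) * (c 0 0 - a 0 0)) * (d 2%:R 0 - a 2%:R 0).
Proof. by rewrite /signed_volume dotmul3 !crossmul3 !mxE. Qed.

Lemma signed_volume_swap12 a b c d : signed_volume b a c d =
  - signed_volume a b c d.
Proof. by rewrite !signed_volumeE; ring. Qed.

Lemma signed_volume_swap23 a b c d : signed_volume a c b d =
  - signed_volume a b c d.
Proof. by rewrite !signed_volumeE; ring. Qed.

Lemma signed_volume_swap34 a b c d : signed_volume a b d c =
  - signed_volume a b c d.
Proof. by rewrite !signed_volumeE; ring. Qed.

(** A nonzero oriented volume stays nonzero under every permutation of the
    vertices, since it changes at most its sign. *)
Lemma signed_volume_neq0 (p : 'I_4 -> 'cV[R]_3) i j l m :
  signed_volume (p 0) (p 1) (p 2%:R) (p 3%:R) != 0 ->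
  uniq [:: i; j; l; m] ->
  signed_volume (p i) (p j) (p l) (p m) != 0.
Proof.
have ord4 (x : 'I_4) : [\/ x = 0, x = 1, x = 2%:R | x = 3%:R].
  case: x => [[|[|[|[|//]]]] h];
    [constructor 1|constructor 2|constructor 3|constructor 4]; exact: val_inj.
set V := signed_volume _ _ _ _ => V0.
have H s : s = V \/ s = - V -> s != 0.
  by case=> ->; rewrite ?oppr_eq0.
case: (ord4 i) => ->; case: (ord4 j) => -> //;
  case: (ord4 l) => -> //; case: (ord4 m) => -> // _;
  apply: H; rewrite /V !signed_volumeE; first [by left; ring | by right; ring].
Qed.

Lemma dotmulZr n (u v : 'cV[R]_n) t : dotmul u (t *: v) = t * dotmul u v.
Proof.
by rewrite /dotmul big_distrr; apply: eq_bigr => i _; rewrite mxE mulrCA.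
Qed.

Lemma dotmul_sumr n (u : 'cV[R]_n) I (r : seq I) (F : I -> 'cV[R]_n) :
  dotmul u (\sum_(i <- r) F i) = \sum_(i <- r) dotmul u (F i).
Proof.
rewrite /dotmul exchange_big; apply: eq_bigr => i _.
by rewrite summxE big_distrr.
Qed.

Lemma dotmul_gt0 n (u : 'cV[R]_n) : u != 0 -> 0 < dotmul u u.
Proof.
have sq_ge0 i : true -> 0 <= u i 0 * u i 0 by rewrite -expr2 sqr_ge0.
move=> u0; rewrite lt_def sumr_ge0 // andbT.
apply: contraNneq u0 => /eqP; rewrite psumr_eq0 //.
move=> /allP h; apply/eqP/colP => i; rewrite mxE.
by have := h i (mem_index_enum i); rewrite mulf_eq0 orbb => /eqP.
Qed.

(** From an interior point one can move a little in any direction. *)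
Lemma interior_segment (S : set 'cV[R]_3) (x v : 'cV[R]_3) : interior S x ->
  exists2 t : R, 0 < t & S (x - t *: v).
Proof.
move=> /nbhs_ballP[e /= e0 he].
exists (e / 2 / (`|v| + 1)).
  by rewrite !divr_gt0 // ltr_wpDl.
apply: he; rewrite -ball_normE /= opprB addrC subrK normrZ.
have v1 : 0 < `|v| + 1 by rewrite ltr_wpDl.
rewrite gtr0_norm ?divr_gt0 // mulrAC ltr_pdivrMr //.
have := normr_ge0 v; nra.
Qed.

(** When all vertices but one lie in a plane through x0 with normal u, the height
    of a point of the hull over this plane is its weight at the remaining
    vertex d times the height of d. *)
Lemma conv_hull_height (I : finType) (q : I -> 'cV[R]_3) (s : {set I})
    (d : I) (u x0 y : 'cV[R]_3) :
  (forall i, i \in s -> i != d -> dotmul u (q i - x0) = 0) ->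
  conv_hull q s y ->
  exists2 w : R, 0 <= w & dotmul u (y - x0) = w * dotmul u (q d - x0).
Proof.
move=> h [w [w0 ws w1 ->]]; exists (w d) => //.
rewrite -[x0 in LHS]scale1r -w1 scaler_suml -sumrB dotmul_sumr.
rewrite (bigD1 d) //= big1 ?addr0; first by rewrite -scalerBr dotmulZr.
move=> i id; rewrite -scalerBr dotmulZr.
case: (boolP (i \in s)) => [/h -> //|/ws ->]; by rewrite ?mulr0 ?mul0r.
Qed.

(** In the same situation, an interior point of the hull lies strictly on the
    side of d. *)
Lemma interior_height_sg (I : finType) (q : I -> 'cV[R]_3) (s : {set I})
    (d : I) (u x0 y : 'cV[R]_3) :
  (forall i, i \in s -> i != d -> dotmul u (q i - x0) = 0) ->
  dotmul u (q d - x0) != 0 ->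
  interior (conv_hull q s) y ->
  Num.sg (dotmul u (y - x0)) = Num.sg (dotmul u (q d - x0)).
Proof.
move=> h D0 iy; set D := dotmul u (q d - x0) in D0 *.
have u0 : u != 0.
  by apply: contraNneq D0 => u0; rewrite /D u0 dotmul3 !mxE !mul0r !addr0.
have [w w0 hw] := conv_hull_height h (interior_subset iy).
(* A step towards the plane stays in the hull, so its weight w' at d is still
   nonnegative although it is smaller than w. *)
have [t t0 /(conv_hull_height h)[w' w'0]] := interior_segment (D *: u) iy.
rewrite -/D.
have -> : dotmul u (y - t *: (D *: u) - x0)
    = dotmul u (y - x0) - t * (D * dotmul u u).
  by rewrite !dotmul3 !mxE; ring.
rewrite hw -/D => e.
suff wp : 0 < w by rewrite sgrM gtr0_sg // mul1r.
have uu := dotmul_gt0 u0.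
have -> : w = w' + t * dotmul u u by apply: (mulIf D0); rewrite mulrDl -e; ring.
by rewrite ltr_wpDl // mulr_gt0.
Qed.

End Vectors.

(** * Enumerations of three and four indices *)

Lemma ord4_complete (i j : 'I_4) : i != j ->
  exists l m : 'I_4, uniq [:: i; j; l; m].
Proof.
move=> ij; have /card_gt1P[l [m [li mi lm]]] : (1 < #|~: [set i; j]|)%N.
  by have := cardsC [set i; j]; rewrite cards2 ij card_ord -(ltn_add2l 2) => ->.
exists l, m; move: li mi; rewrite !inE !negb_or => /andP[li lj] /andP[mi mj].
by rewrite /= !inE !negb_or ij lm ![i == _]eq_sym ![j == _]eq_sym li lj mi mj.
Qed.

Lemma mem_ord4 (i j l m x : 'I_4) : uniq [:: i; j; l; m] ->
  x \in [:: i; j; l; m].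
Proof.
move=> u; pose s := [:: i; j; l; m].
suff [_ ->] : (size s = size (enum 'I_4)) * (s =i enum 'I_4).
  by rewrite mem_enum.
apply: uniq_min_size => //; first by move=> y _; rewrite mem_enum.
by rewrite -cardE card_ord.
Qed.

Lemma cards3_uniq (T : finType) (x y z : T) :
  uniq [:: x; y; z] -> #|[set x; y; z]%SET| = 3%N.
Proof.
rewrite /= !inE !negb_or => /andP[/andP[xy xz] /andP[yz _]].
by rewrite -finset.setUA cardsU1 cards2 !inE negb_or xy xz yz.
Qed.

Lemma vset3 n (c : 'I_3 -> 'I_n) : vset c = [set c 0; c 1; c 2%:R]%SET.
Proof.
apply/setP => x; apply/imsetP/idP.
  case=> [[[|[|[|//]]] h]] _ ->; rewrite !inE -!orbA; apply/or3P;
  [constructor 1|constructor 2|constructor 3];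
  by apply/eqP; congr c; apply: val_inj.
by rewrite !inE -!orbA => /or3P[] /eqP->; eexists.
Qed.

Lemma vset2 n (c : 'I_2 -> 'I_n) : vset c = [set c 0; c 1]%SET.
Proof.
apply/setP => x; apply/imsetP/idP.
  case=> [[[|[|//]] h]] _ ->; rewrite !inE; apply/orP;
  [left|right]; apply/eqP; congr c; exact: val_inj.
by rewrite !inE => /orP[] /eqP->; eexists.
Qed.

Lemma vset3_cases n (c : 'I_3 -> 'I_n) x y z : uniq [:: x; y; z] ->
  vset c = [set x; y; z]%SET ->
  [\/ [/\ c 0 = x, c 1 = y & c 2%:R = z], [/\ c 0 = y, c 1 = z & c 2%:R = x],
      [/\ c 0 = z, c 1 = x & c 2%:R = y] |
  [\/ [/\ c 0 = y, c 1 = x & c 2%:R = z], [/\ c 0 = x, c 1 = z & c 2%:R = y] |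
      [/\ c 0 = z, c 1 = y & c 2%:R = x]]].
Proof.
rewrite vset3 => u /setP h.
have hx := h x; have hy := h y; have hz := h z.
have h0 := h (c 0); have h1 := h (c 1); have h2 := h (c 2%:R).
move: hx hy hz h0 h1 h2; rewrite !inE !eqxx ?orbT /= -!orbA.
move=> hx hy hz /esym/or3P h0 /esym/or3P h1 /esym/or3P h2.
move: u; rewrite /= !inE !negb_or => /andP[/andP[xy xz] /andP[yz _]].
move: hx hy hz.
have yx : (y == x) = false by rewrite eq_sym; apply/negbTE.
have zx : (z == x) = false by rewrite eq_sym; apply/negbTE.
have zy : (z == y) = false by rewrite eq_sym; apply/negbTE.
move: xy xz yz => /negbTE xy /negbTE xz /negbTE yz.
case: h0 => /eqP ->; case: h1 => /eqP ->; case: h2 => /eqP ->;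
  rewrite ?eqxx ?xy ?xz ?yz ?yx ?zx ?zy //= => _ _ _;
  by [constructor 1 | constructor 2 | constructor 3
     | constructor 4; constructor 1 | constructor 4; constructor 2
     | constructor 4; constructor 3].
Qed.

(** * Incidence of faces and edges in a tetrahedron *)

Section Mesh.
Variables (R : realType) (M : delaunay_mesh R).
Implicit Types (f : 'I_(nF M)) (e : 'I_(nE M)) (k : 'I_(nT M)).
Implicit Types (c d : 'I_(nP M)).

Lemma vset_tet k (i j l m : 'I_4) : uniq [:: i; j; l; m] ->
  vset (tet k) = [set tet k i; tet k j; tet k l; tet k m]%SET.
Proof.
move=> u; apply/setP => x; apply/imsetP/idP.
  case=> y _ ->; have := mem_ord4 y u; rewrite !inE.
  by move=> /or4P[] /eqP->; rewrite eqxx ?orbT.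
by rewrite !inE -!orbA => /or4P[] /eqP->; eexists.
Qed.

Lemma tet_volume_neq0 k (i j l m : 'I_4) : uniq [:: i; j; l; m] ->
  signed_volume (pt (tet k i)) (pt (tet k j)) (pt (tet k l)) (pt (tet k m))
    != 0.
Proof.
by apply: (signed_volume_neq0 (p := fun i => pt (tet k i)));
  apply: tet_nondegenerate.
Qed.

Lemma tet_vertex_inj k : injective (tet k).
Proof.
move=> i j e; apply/eqP; apply: contraT => /ord4_complete[l [m u]].
have := tet_volume_neq0 k u; rewrite e signed_volumeE.
by rewrite !subrr !mul0r !subr0 !mul0r !addr0 eqxx.
Qed.

Lemma KE f e : K M f e =
  ((edge e 0 == face f 0) && (edge e 1 == face f 1))%:R
     - ((edge e 1 == face f 0) && (edge e 0 == face f 1))%:R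
  + (((edge e 0 == face f 1) && (edge e 1 == face f 2%:R))%:R
     - ((edge e 1 == face f 1) && (edge e 0 == face f 2%:R))%:R)
  + (((edge e 0 == face f 2%:R) && (edge e 1 == face f 0))%:R
     - ((edge e 1 == face f 2%:R) && (edge e 0 == face f 0))%:R).
Proof.
have h1 : (1 + 1 : 'I_3) = 2%:R by exact: val_inj.
have h3 : (2%:R + 1 : 'I_3) = 0 by exact: val_inj.
by rewrite mxE !big_ord_recl big_ord0 addr0 addrA ord3_1 ord3_2 add0r h1 h3.
Qed.

(** As the circumcenter of a tetrahedron is interior, it is on the same side of a
    face as the opposite vertex d, so that the Voronoi incidence number is the
    sign of an oriented volume. *)
Lemma GV_sg f k d :
  vset (tet k) = [set face f 0; face f 1; face f 2%:R; d]%SET ->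
  let V := signed_volume (pt (face f 0)) (pt (face f 1)) (pt (face f 2%:R))
    (pt d) in
  V != 0 -> GV M f k = Num.sg V.
Proof.
move=> tE V V0; rewrite mxE ifT; last first.
  by rewrite vset3 tE; apply/fintype.subsetP => x; rewrite !inE => ->.
apply: interior_height_sg (circumcenter_interior k) => // i.
rewrite tE !inE -!orbA => /or4P[] /eqP-> //.
(* The plane through the face contains its three vertices. *)
- by move=> _; rewrite dotmul3 !mxE; ring.
- by move=> _; rewrite /face_normal dotmul3 !crossmul3 !mxE; ring.
- by move=> _; rewrite /face_normal dotmul3 !crossmul3 !mxE; ring.
by rewrite eqxx.
Qed.

(** The product of the two incidence numbers does not depend on the orientation
    of the face: reversing it changes the sign of both. *)
Lemma GV_K_sg f e k c d :
  uniq [:: edge e 0; edge e 1; c; d] ->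
  vset (tet k) = [set edge e 0; edge e 1; c; d]%SET ->
  vset (face f) = [set edge e 0; edge e 1; c]%SET ->
  let V := signed_volume (pt (edge e 0)) (pt (edge e 1)) (pt c) (pt d) in
  V != 0 -> GV M f k * K M f e = Num.sg V.
Proof.
set a := edge e 0; set b := edge e 1 => u tE fE V V0.
have uf : uniq [:: a; b; c] by exact: (@take_uniq _ _ 3) u.
have tE' : vset (tet k) = [set face f 0; face f 1; face f 2%:R; d]%SET.
  by rewrite tE -fE vset3.
pose W := signed_volume (pt (face f 0)) (pt (face f 1)) (pt (face f 2%:R))
  (pt d).
(* The vertices of the face are an even or an odd permutation of a, b, c,
   according to whether the face traverses the edge forwards or backwards. *)
have hK : W = V /\ K M f e = 1 \/ W = - V /\ K M f e = -1.
  rewrite KE -/a -/b /W.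
  move: (uf); rewrite /= !inE !negb_or.
  move=> /andP[/andP[/negbTE ab /negbTE ac] /andP[/negbTE bc _]].
  have [ba ca cb] : [/\ (b == a) = false, (c == a) = false & (c == b) = false].
    by split; rewrite eq_sym.
  have simp := (subr0, sub0r, addr0, add0r).
  have [||| []] := vset3_cases uf fE => -[-> -> ->];
    rewrite ?eqxx ?ab ?ac ?bc ?ba ?ca ?cb /= !simp.
  - by left.
  - by left; rewrite signed_volume_swap23 signed_volume_swap12 opprK.
  - by left; rewrite signed_volume_swap12 signed_volume_swap23 opprK.
  - by right; rewrite signed_volume_swap12.
  - by right; rewrite signed_volume_swap23.
  - right; rewrite signed_volume_swap12 signed_volume_swap23.
    by rewrite signed_volume_swap12 opprK.
have W0 : W != 0 by case: hK => [[-> _]|[-> _]]; rewrite ?oppr_eq0.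
rewrite (GV_sg tE' W0) -/W.
case: hK => [[-> ->]|[-> ->]]; first by rewrite mulr1.
by rewrite sgrN mulrN1 opprK.
Qed.

Lemma K_eq0 f e :
  ~~ ((edge e 0 \in vset (face f)) && (edge e 1 \in vset (face f))) ->
  K M f e = 0.
Proof.
rewrite mxE => h; apply: big1 => i _.
have hf j : face f j \in vset (face f) by exact: imset_f.
have e01 x y : (edge e 0 == face f x) && (edge e 1 == face f y) = false.
  by apply: contraNF h => /andP[/eqP -> /eqP ->]; rewrite !hf.
by rewrite e01 andbC e01 subrr.
Qed.

Lemma K_neq0_edge_sub f e : K M f e != 0 -> vset (edge e) \subset vset (face f).
Proof.
move=> h; rewrite vset2 finset.subUset !finset.sub1set; apply: contraR h => h.
by rewrite K_eq0.
Qed.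

(** A face of the mesh that contains a listed edge is listed: were it inside an
    essential face, so would the edge be. *)
Lemma exists_face e k (s : {set 'I_(nP M)}) :
  vset (edge e) \subset s -> s \subset vset (tet k) -> #|s| = 3%N ->
  exists f, vset (face f) = s.
Proof.
move=> es sk s3; have [_ h] := face_enum M; apply/h; split=> //.
  by apply/existsP; exists k.
move=> g gB; have [_ he] := edge_enum M.
have [/(_ (ex_intro _ e erefl))[_ _ /(_ g gB)]] := he (vset (edge e)).
by move=> + _; apply: contra; apply: fintype.subset_trans.
Qed.

(** Entry (k, e) vanishes because an edge of a tetrahedron lies in exactly two of
    its faces, and these contribute opposite signs. *)
Lemma GVT_K : (GV M)^T *m K M = 0.
Proof.
apply/matrixP => k e; rewrite !mxE.
under eq_bigr do rewrite mxE.
have GV0 f : ~~ (vset (face f) \subset vset (tet k)) -> GV M f k = 0.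
  by rewrite mxE => /negbTE ->.
have [ek|nek] := boolP (vset (edge e) \subset vset (tet k)); last first.
  rewrite big1 // => f _.
  have [->|Kn0] := eqVneq (K M f e) 0; first by rewrite mulr0.
  rewrite GV0 ?mul0r //; apply: contra nek; apply: fintype.subset_trans.
  exact: K_neq0_edge_sub.
have [_ /(_ (vset (edge e)))[/(_ (ex_intro _ e erefl))[ec _ _] _]] :=
  edge_enum M.
move: (ek) ec; rewrite vset2 finset.subUset !finset.sub1set cards2.
move=> /andP[/imsetP[i _ ei] /imsetP[j _ ej]].
rewrite ei ej; case: eqVneq => // neq _.
have /ord4_complete[l [m u]] : i != j by apply: contraNneq neq => ->.
have um : uniq [:: edge e 0; edge e 1; tet k l; tet k m].
  rewrite ei ej -[uniq _]/(uniq (map (tet k) [:: i; j; l; m])) map_inj_uniq //.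
  exact: tet_vertex_inj.
have V0 := tet_volume_neq0 k u; rewrite -ei -ej in V0.
have tE := vset_tet k u; rewrite -ei -ej in tE.
set c := tet k l in um V0 tE; set d := tet k m in um V0 tE.
set a := edge e 0 in um V0 tE *; set b := edge e 1 in um V0 tE *.
have eE : vset (edge e) = [set a; b]%SET by rewrite vset2.
have um' : uniq [:: a; b; d; c].
  rewrite (@perm_uniq _ _ [:: a; b; c; d]) // !perm_cons.
  by rewrite (perm_catC [:: d] [:: c]).
have tE' : vset (tet k) = [set a; b; d; c]%SET by rewrite tE finset.setUAC.
have uniq3 (x y z t : 'I_(nP M)) :
    uniq [:: x; y; z; t] -> uniq [:: x; y; z].
  exact: (@take_uniq _ _ 3).
have exf x y : uniq [:: a; b; x; y] -> vset (tet k) = [set a; b; x; y]%SET ->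
    exists f, vset (face f) = [set a; b; x]%SET.
  move=> uxy txy; apply: (@exists_face e k);
    last exact: (cards3_uniq (uniq3 _ _ _ _ uxy)).
    by rewrite eE finset.subsetUl.
  by rewrite txy finset.subsetUl.
have [f1 f1E] := exf _ _ um tE; have [f2 f2E] := exf _ _ um' tE'.
have f21 : f2 != f1.
  apply: contraTneq um => f12; move: f2E; rewrite f12 f1E => /finset.setP/(_ d).
  rewrite !inE eqxx !orbT /= !inE !negb_or ![d == _]eq_sym.
  by move=> /orP[/orP[]|] ->; rewrite ?andbF.
rewrite (bigD1 f1) //= (bigD1 f2) //= big1 => [|f /andP[ff1 ff2]].
  rewrite (GV_K_sg um tE f1E V0) (GV_K_sg um' tE' f2E).
    by rewrite signed_volume_swap34 sgrN addr0 addNr.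
  by rewrite signed_volume_swap34 oppr_eq0.
(* Any further face of the tetrahedron containing the edge would have c or d as
   its third vertex, hence be f1 or f2. *)
have [->|Kn0] := eqVneq (K M f e) 0; first by rewrite mulr0.
have [fk|/GV0 ->] := boolP (vset (face f) \subset vset (tet k));
  last by rewrite mul0r.
have := K_neq0_edge_sub Kn0; rewrite eE => abf.
have [f_inj /(_ (vset (face f)))[/(_ (ex_intro _ f erefl))[f3 _ _] _]] :=
  face_enum M.
have [x xf xab] : exists2 x, x \in vset (face f) & x \notin [set a; b]%SET.
  apply/fintype.subsetPn; apply/negP => /subset_leq_card.
  by rewrite f3 cards2; case: (_ != _).
have sx : [set a; b; x]%SET \subset vset (face f).
  by rewrite finset.subUset abf finset.sub1set.
have fx y : uniq [:: a; b; x; y] -> vset (face f) = [set a; b; x]%SET.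
  move=> /uniq3/cards3_uniq c3; apply/esym/eqP.
  by rewrite finset.eqEcard sx f3 c3.
have := fintype.subsetP fk _ xf; rewrite tE !inE in xab *.
rewrite -orbA (negbTE xab) /= => /orP[]/eqP xE; rewrite xE in fx.
  by move: ff1; rewrite (f_inj f f1) ?eqxx // f1E (fx _ um).
by move: ff2; rewrite (f_inj f f2) ?eqxx // f2E (fx _ um').
Qed.

Lemma face_area_neq0 f : face_area f != 0.
Proof.
have [_ /(_ (vset (face f)))[/(_ (ex_intro _ f erefl)) + _]] := face_enum M.
move=> [f3 /existsP[k fk] _].
have fi i : exists j, face f i = tet k j.
  have fiv : face f i \in vset (face f) by exact: imset_f.
  by have /imsetP[j _ ->] := fintype.subsetP fk _ fiv; exists j.
move: f3; rewrite vset3 -finset.setUA cardsU1 cards2 !inE negb_or.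
have [[j0 e0] [j1 e1] [j2 e2]] := And3 (fi 0) (fi 1) (fi 2%:R).
rewrite e0 e1 e2 !(inj_eq (@tet_vertex_inj k)).
move=> j3; have [j01 j02 j12] : [/\ j0 != j1, j0 != j2 & j1 != j2].
  by move: j3; do 3 case: (_ == _).
have [m u] : exists m, uniq [:: j0; j1; j2; m].
  have [l [m u]] := ord4_complete j01.
  have /orP[/eqP ->|/eqP ->] : (j2 == l) || (j2 == m).
  - have := mem_ord4 j2 u.
    rewrite !inE [j2 == j0]eq_sym [j2 == j1]eq_sym.
    by rewrite (negbTE j02) (negbTE j12).
  - by exists m.
  - exists l; rewrite (@perm_uniq _ _ [:: j0; j1; l; m]) // !perm_cons.
    by rewrite (perm_catC [:: m] [:: l]).
have V0 := tet_volume_neq0 k u; rewrite -e0 -e1 -e2 in V0.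
have n0 : face_normal f != 0.
  apply: contraNneq V0 => n0.
  rewrite /signed_volume -[crossmul _ _]/(face_normal f) n0.
  by rewrite dotmul3 !mxE !mul0r !addr0.
by rewrite mulf_neq0 ?invr_eq0 ?pnatr_eq0 // gt_eqF // sqrtr_gt0 dotmul_gt0.
Qed.

(** The face areas of the two operators cancel, because they are nonzero. *)
Lemma divV_curlD : divV M *m curlD M = 0.
Proof.
have u : DdD M \in unitmx.
  rewrite unitmxE det_diag unitfE; apply/prodf_neq0 => f _.
  by rewrite mxE face_area_neq0.
rewrite /divV /curlD !mulmxA mulmxK // -(mulmxA (invmx (DD M))) GVT_K.
by rewrite mulmx0 mul0mx.
Qed.

End Mesh.

(** * Krylov spaces inside a kernel *)

(** No invertibility is needed: invmx leaves singular matrices unchanged. *)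
Lemma mul_row_invmx (R : realType) m n (P : 'M[R]_(m, n)) (A : 'M[R]_n) :
  P *m A = P -> P *m invmx A = P.
Proof.
move=> PA; case: (boolP (A \in unitmx)) => [Au|/invmx_out -> //].
by rewrite -{1}PA mulmxK.
Qed.

(** If the rows of P span a space on which both the preconditioner X and the
    system matrix A act from the right as scalars, and P annihilates the data, then
    P annihilates the whole Krylov space. *)
Lemma mul_krylov (R : realType) m n (P : 'M[R]_(m, n)) (X A : 'M[R]_n)
    (b x0 v : 'cV[R]_n) s a k :
  P *m X = s *: P -> P *m A = a *: P -> P *m b = 0 -> P *m x0 = 0 ->
  v \in krylov X A b x0 k -> P *m v = 0.
Proof.
move=> PX PA Pb Px0.
have PXA u : P *m u = 0 -> P *m (X *m A *m u) = 0.
  by move=> Pu; rewrite !mulmxA PX -!scalemxAl PA -scalemxAl Pu !scaler0.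
have Pr : P *m (X *m (b - A *m x0)) = 0.
  rewrite mulmxA PX -scalemxAl mulmxBr Pb mulmxA PA -scalemxAl Px0.
  by rewrite scaler0 subr0 scaler0.
rewrite /krylov => /coord_span ->; rewrite mulmx_sumr big1 // => i _.
rewrite -scalemxAr.
set r := X *m (b - A *m x0) in Pr *.
suff Pu u : u \in [seq (X *m A) ^+ j *m r | j <- iota 0 k] -> P *m u = 0.
  by rewrite (Pu _ (mem_nth _ _)) ?scaler0 // size_map size_iota.
move=> /mapP[j _ ->]; elim: j => [|j IHj]; first by rewrite expr0 mul1mx.
by rewrite exprS -mulmxE -[_ *m _ *m r]mulmxA PXA.
Qed.

(** * Invariance of the divergence constraint *)

(** The block row (divV, 0, 0), which maps (B, E, p) to divV B. *)
Definition divV_row (R : realType) (M : delaunay_mesh R) :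
    'M[R]_(nT M, dofs M) := row_mx (divV M) 0.

Section Invariance.
Variables (R : realType) (M : delaunay_mesh R).

Lemma divV_row_col3 B E p : divV_row M *m col3 B E p = divV M *m B.
Proof. by rewrite mul_row_col mul0mx addr0. Qed.

Lemma divV_row_block3 a11 a12 a13 a21 a22 a23 a31 a32 a33 s :
  divV M *m a11 = s *: divV M -> divV M *m a12 = 0 -> divV M *m a13 = 0 ->
  divV_row M *m block3 a11 a12 a13 a21 a22 a23 a31 a32 a33 = s *: divV_row M.
Proof.
move=> h1 h2 h3.
rewrite /divV_row mul_row_block !mul0mx !addr0 h1 mul_mx_row h2 h3.
by rewrite row_mx0 scale_row_mx scaler0.
Qed.

Lemma divV_row_L tau : divV_row M *m L_mx M tau = divV_row M.
Proof.
rewrite -[RHS]scale1r; apply: divV_row_block3; rewrite ?mulmx0 //.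
by rewrite mulmx1 scale1r.
Qed.

Lemma divV_row_Q tau QE Qp :
  exists s, divV_row M *m Q_mx tau QE Qp = s *: divV_row M.
Proof.
exists (2%:R / tau)^-1.
by apply: divV_row_block3; rewrite ?mulmx0 // invmx_scalar mul_mx_scalar.
Qed.

Lemma divV_row_U tau : divV_row M *m U_mx M tau = divV_row M.
Proof.
rewrite -[RHS]scale1r; apply: divV_row_block3;
  rewrite ?mulmx1 ?mulmx0 ?scale1r //.
by rewrite -scalemxAr divV_curlD scaler0.
Qed.

Lemma divV_row_system tau :
  divV_row M *m system_mx M tau = (2%:R / tau) *: divV_row M.
Proof.
by apply: divV_row_block3; rewrite ?mulmx0 ?divV_curlD // mul_mx_scalar.
Qed.

Lemma divV_row_X tau QE Qp X :
  X = X_LS tau QE Qp \/ X = X_SU tau QE Qp \/ X = X_LSU tau QE Qp ->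
  exists s, divV_row M *m X = s *: divV_row M.
Proof.
have [s hQ] := divV_row_Q tau QE Qp.
have hL := mul_row_invmx (divV_row_L tau).
have hU := mul_row_invmx (divV_row_U tau).
by case=> [|[]] ->; exists s; rewrite ?mulmxA ?hU hQ -?scalemxAl ?hL.
Qed.

End Invariance.

Theorem theorem5p2 (R : realType) (M : delaunay_mesh R) (tau : R)
    (QE : 'M[R]_(nE M)) (Qp : 'M[R]_(nV M)) (X : 'M[R]_(dofs M))
    (B0 gB : 'cV[R]_(nF M)) (E0 gE : 'cV[R]_(nE M)) (p0 gp : 'cV[R]_(nV M)) :
  0 < tau ->
  X = X_LS tau QE Qp \/ X = X_SU tau QE Qp \/ X = X_LSU tau QE Qp ->
  divV M *m B0 = 0 ->
  divV M *m gB = 0 ->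
  forall (k : nat) (Bk : 'cV[R]_(nF M)) (Ek : 'cV[R]_(nE M)) (pk : 'cV[R]_(nV M)),
    gmres_iterate X (system_mx M tau) (col3 gB gE gp) (col3 B0 E0 p0) k
      (col3 Bk Ek pk) ->
    divV M *m Bk = 0.
Proof.
move=> _ /divV_row_X[s PX] B0_0 gB_0 k Bk Ek pk [kry _].
have P0 : divV_row M *m col3 B0 E0 p0 = 0 by rewrite divV_row_col3.
have Pg : divV_row M *m col3 gB gE gp = 0 by rewrite divV_row_col3.
have := mul_krylov PX (divV_row_system M tau) Pg P0 kry.
by rewrite mulmxBr P0 subr0 divV_row_col3.
Qed.
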